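(* For every $n\in\mathbb N$, the threshold bias for the connected Client-Waiter odd cycle game satisfies $$b_{cw}^c(\mathcal{OC}_n) = \lceil n/2\rceil - 1 .$$
   Context: $K_n$ is the complete graph on the vertex set $[n]=\{1,\dots,n\}$, and $\mathcal{OC}_n=\{E(C) : C \text{ an odd cycle in } K_n\}$. Connected (monotone, biased) Client-Waiter game with bias $b\ge 0$ and winning sets $\mathcal F\subset 2^{E(K_n)}$: in every round, Waiter offers Client a set of $t$ previously unclaimed edges of $K_n$, where $1\le t\le b+1$ is chosen by Waiter. Client chooses exactly one of the offered edges and claims it; the remaining $t-1$ offered edges are claimed by Waiter. In the first round all offered edges must be incident to a single vertex (which may be fixed arbitrarily in advance, since the board is complete). In each later round Waiter may only offer edges that share at least one vertex with some edge already claimed by Client. If there are still unclaimed edges but none of them may be offered under this rule, Client wins. Otherwise the game continues until all edges are claimed. Client wins if she has claimed all edges of some $F\in\mathcal F$, and Waiter wins otherwise. The threshold bias $b_{cw}^c(\mathcal F)$ is the integer such that Waiter has a winning strategy in this game with bias $b$ if and only if $b\ge b_{cw}^c(\mathcal F)$. *)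

(* Defs.v *)
From mathcomp Require Import all_boot.

Set Implicit Arguments.
Unset Strict Implicit.
Unset Printing Implicit Defensive.

Notation edge n := {set 'I_n}.

Definition Kn_edges (n : nat) : {set edge n} := [set e : edge n | #|e| == 2].

Definition cycle_edges (n : nat) (c : seq 'I_n) : {set edge n} :=
  [set [set x; next c x] | x in c].

(* The family OC_n, as a predicate on edge sets.  The vertices of a cycle are
   listed in cyclic order. *)
Definition odd_cycles (n : nat) (F : {set edge n}) : Prop :=
  exists c : seq 'I_n,
    [/\ uniq c, 3 <= size c, odd (size c) & F = cycle_edges c].

(* A history records for each past round the set offered by Waiter and the edge
   of it chosen by Client, the most recent round coming first. *)
Definition history (n : nat) := seq ({set edge n} * edge n).

Section Game.

Variables (n b : nat) (winning : {set edge n} -> Prop).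
Implicit Types (h : history n) (O : {set edge n}) (sigma : history n -> {set edge n}).

Definition client_edges h : {set edge n} := [set e in map snd h].

Definition claimed_edges h : {set edge n} := \bigcup_(r <- h) r.1.

Definition unclaimed_edges h : {set edge n} := Kn_edges n :\: claimed_edges h.

(* The edges that may individually be offered in the next round. *)
Definition offerable_edges h : {set edge n} :=
  if h is [::] then unclaimed_edges h
  else [set e in unclaimed_edges h |
          [exists f in client_edges h, e :&: f != set0]].

Definition legal_offer h O : Prop :=
  [/\ O \subset offerable_edges h,
      1 <= #|O| <= b.+1 &
      h = [::] -> exists v : 'I_n, forall e, e \in O -> v \in e].

(* True both when the board is exhausted and when Waiter is stuck. *)
Definition game_over h : Prop := offerable_edges h = set0.

(* The outcome of a finished game: Waiter loses if stuck with edges unclaimed. *)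
Definition waiter_won h : Prop :=
  unclaimed_edges h = set0 /\
  ~ exists2 F, winning F & F \subset client_edges h.

Inductive reachable sigma : history n -> Prop :=
| reachable_start : reachable sigma [::]
| reachable_round h e :
    reachable sigma h -> ~ game_over h -> e \in sigma h ->
    reachable sigma ((sigma h, e) :: h).

(* Every round claims an edge, so play under a legal sigma always terminates and
   it suffices to look at the reachable finished games. *)
Definition winning_strategy sigma : Prop :=
  forall h, reachable sigma h ->
    (~ game_over h -> legal_offer h (sigma h)) /\
    (game_over h -> waiter_won h).

Definition waiter_wins : Prop := exists sigma, winning_strategy sigma.

End Game.

Definition is_threshold_bias (n : nat) (winning : {set edge n} -> Prop)
    (t : nat) : Prop :=
  forall b : nat, waiter_wins b winning <-> t <= b.

(* Main.v *)
Require Import Defs.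
From mathcomp Require Import all_boot.
From mathcomp Require Import all_fingroup zify.
From Stdlib Require Import ClassicalEpsilon.

Set Implicit Arguments.
Unset Strict Implicit.
Unset Printing Implicit Defensive.

(** Write [q = b + 1] for the largest size of an offer. The bound [n <= 2 q] is
    equivalent to [ceil (n / 2) - 1 <= b], so Client must be shown to survive
    when [n >= 2 q + 1] and Waiter to win when [n <= 2 q].

    Client, [n >= 2 q + 1]. Client builds a path and always extends it at its
    latest vertex, keeping this invariant ([path_state]): all edges inside the
    path are claimed, and a vertex [x] outside it has claimed edges exactly to
    an initial segment of the path, which misses the latest vertex. If an offer
    contains some but not all of the unclaimed edges from [x] to the path, then
    there are consecutive path vertices [u], [v] such that [x u] is offered while
    [x v] is unclaimed and not offered; Client takes [x u] and is sure to complete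
    the triangle [x u v] later ([no_threat], [offer_all_or_none]). Otherwise every
    vertex touched by the offer is offered with all its unclaimed edges to the
    path, in particular with the edge to the latest vertex, and the path can be
    extended ([path_extend]). After at most [n - 1] rounds at most
    [q (n - 1) < n (n - 1) / 2] edges are claimed, so the game is not over
    ([not_over]), and the path would grow beyond [n] vertices.

    Waiter, [n <= 2 q]. In each of [n - 1] rounds Client's tree gets a new vertex.
    For [n = 2 q] the board has [q (n - 1)] edges, so that every offer must then
    consist of [q] edges. This is achieved as follows. Order the vertices by
    positions [0 .. n-1]. After [k] rounds Client has a tree on the
    first [k + 1] vertices, and the edge between positions [i < j] is claimed iff
    [j <= k], or [i < k] and [i + q < j] ([taken]). In the next round Waiter
    offers the edges needed to pass from [k] to [k + 1]; there are at most [q] of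
    them ([card_offered]). Each has exactly one endpoint in the tree, so that Client's
    graph stays bipartite. If Client's new vertex is not the one in position
    [k + 1], the two have the same claimed edges after the round and exchange
    their positions ([taken_swap]). *)

(** * Edges, offers and histories *)

Section Generalities.

Variables (n b : nat) (winning : {set edge n} -> Prop).
Implicit Types (h : history n) (O : {set edge n}) (e : edge n).

Lemma edge_in_Kn (x y : 'I_n) : ([set x; y] \in Kn_edges n) = (x != y).
Proof. by rewrite inE cards2; case: (x != y). Qed.

Lemma client_edges_cons (r : {set edge n} * edge n) h :
  client_edges (r :: h) = r.2 |: client_edges h.
Proof. by apply/setP => f; rewrite !inE. Qed.

Lemma claimed_edges_cons (r : {set edge n} * edge n) h :
  claimed_edges (r :: h) = r.1 :|: claimed_edges h.
Proof. by rewrite /claimed_edges big_cons. Qed.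

Lemma client_edges_nil : client_edges [::] = set0 :> {set edge n}.
Proof. by apply/setP => f; rewrite !inE. Qed.

Lemma claimed_edges_nil : claimed_edges [::] = set0 :> {set edge n}.
Proof. by rewrite /claimed_edges big_nil. Qed.

Lemma offerable_unclaimed h : offerable_edges h \subset unclaimed_edges h.
Proof. by case: h => [|r h] //; apply/subsetP => e; rewrite inE => /andP[]. Qed.

Lemma won_all_claimed h e :
  waiter_won winning h -> e \in Kn_edges n -> e \in claimed_edges h.
Proof.
move=> [un0 _] eK; apply: contraT => nce.
by have : e \in unclaimed_edges h; [rewrite inE nce | rewrite un0 inE].
Qed.

(** Waiter wins as soon as he can keep up an invariant [I] that forces his win
    in finished games. *)
Lemma invariant_waiter_wins (I : history n -> Prop) :
    I [::] ->
    (forall h, I h -> ~ game_over h ->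
       exists O, legal_offer b h O /\ forall e, e \in O -> I ((O, e) :: h)) ->
    (forall h, I h -> game_over h -> waiter_won winning h) ->
  waiter_wins b winning.
Proof.
move=> I0 Istep Iend.
pose good h O := legal_offer b h O /\ forall e, e \in O -> I ((O, e) :: h).
pose sigma h := epsilon (inhabits set0) (good h).
have sigmaP h : I h -> ~ game_over h -> good h (sigma h).
  by move=> Ih nov; apply: epsilon_spec; apply: Istep.
exists sigma => h hr.
have Ih : I h.
  by elim: hr => // {}h e _ Ih nov eh; apply: (sigmaP h Ih nov).2.
by split=> [nov|]; [exact: (sigmaP h Ih nov).1 | exact: Iend].
Qed.

End Generalities.

(** * Client's strategy: a path, then a triangle *)

Lemma triangle_odd n (x y z : 'I_n) (F : {set edge n}) :
    x != y -> y != z -> x != z ->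
    [set x; y] \in F -> [set y; z] \in F -> [set x; z] \in F ->
  exists2 C, odd_cycles C & C \subset F.
Proof.
move=> xy yz xz Fxy Fyz Fxz; exists (cycle_edges [:: x; y; z]).
  by exists [:: x; y; z]; split=> //=; rewrite !inE negb_or xy xz yz.
apply/subsetP => _ /imsetP[u + ->]; rewrite !inE.
case/or3P => /eqP -> /=; rewrite ?eqxx //.
  by rewrite [y == x]eq_sym (negPf xy).
by rewrite [z == x]eq_sym [z == y]eq_sym (negPf xz) (negPf yz) setUC.
Qed.

Section Client.

Variables (n b : nat) (sigma : history n -> {set edge n}).
Hypothesis sigma_wins : winning_strategy b (@odd_cycles n) sigma.
Implicit Types (h : history n) (x y z : 'I_n) (w : seq 'I_n).

Lemma offer_legal h :
  reachable sigma h -> ~ game_over h -> legal_offer b h (sigma h).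
Proof. by move=> /sigma_wins[+ _]. Qed.

Lemma offer_unclaimed h e :
    reachable sigma h -> ~ game_over h -> e \in sigma h ->
  e \in unclaimed_edges h.
Proof.
move=> hr nov; have [/subsetP sub _ _] := offer_legal hr nov.
by move=> /sub; apply/subsetP/offerable_unclaimed.
Qed.

(** Two sides of a triangle in Client's graph beat Waiter if Client also has
    the third side or can still get it: this side must be offered at some time,
    and Client then takes it. *)
Lemma no_threat h x y z :
    reachable sigma h -> x != y -> y != z -> x != z ->
    [set x; y] \in client_edges h -> [set y; z] \in client_edges h ->
    [set x; z] \in client_edges h :|: unclaimed_edges h ->
  False.
Proof.
move=> + xy yz xz.
have [m] := ubnP #|unclaimed_edges h|.
elim: m h => // m IH h lem hr Cxy Cyz Cxz.
have [ov|nov] := eqVneq (offerable_edges h) set0.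
  have won := (sigma_wins hr).2 ov; have [un0 []] := won.
  apply: (triangle_odd xy yz xz) => //.
  by move: Cxz; rewrite un0 setU0.
have {}nov : ~ game_over h by apply/eqP.
have [_ /andP[O0 _] _] := offer_legal hr nov.
have next e : e \in sigma h ->
    [set x; z] \in client_edges ((sigma h, e) :: h)
      :|: unclaimed_edges ((sigma h, e) :: h) -> False.
  move=> eO Cxz'; apply: IH (Cxz'); rewrite ?client_edges_cons; last 3 first.
  - exact: reachable_round.
  - by rewrite in_setU Cxy orbT.
  - by rewrite in_setU Cyz orbT.
  apply: leq_trans (proper_card _) _; last by rewrite -ltnS; exact: lem.
  apply/properP; split.
    apply/subsetP => f; rewrite !in_setD claimed_edges_cons in_setU.
    by rewrite negb_or -andbA => /and3P[_ -> ->].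
  exists e; first exact: offer_unclaimed.
  by rewrite in_setD claimed_edges_cons in_setU eO.
have [xzO|xzO] := boolP ([set x; z] \in sigma h).
  by apply: (next _ xzO); rewrite client_edges_cons !inE eqxx.
have /set0Pn[e eO] : sigma h != set0 by rewrite -card_gt0.
apply: (next e eO); move: Cxz.
rewrite client_edges_cons !in_setU !in_setD claimed_edges_cons in_setU.
by rewrite (negPf xzO) /= => /orP[->|->]; rewrite !orbT.
Qed.

Lemma card_claimed h : reachable sigma h -> #|claimed_edges h| <= b.+1 * size h.
Proof.
elim=> [|{}h e hr IH nov eO]; first by rewrite claimed_edges_nil cards0.
rewrite claimed_edges_cons mulnS.
apply: leq_trans (leq_card_setU _ _) _; apply: leq_add IH.
by have [_ /andP[]] := offer_legal hr nov.
Qed.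

(** With at least [2b+3] vertices, [n-1] rounds cannot exhaust the board. *)
Lemma not_over h :
    b.+1.*2 < n -> reachable sigma h -> size h < n -> ~ game_over h.
Proof.
move=> nb hr hn ov; have won := (sigma_wins hr).2 ov.
have : 'C(n, 2) <= b.+1 * size h.
  apply: leq_trans (card_claimed hr).
  rewrite -[n in 'C(n, _)]card_ord -card_draws; apply/subset_leq_card/subsetP.
  move=> e eK; exact: (won_all_claimed won).
rewrite bin2 => le2.
have halfK : n * n.-1 = (n * n.-1)./2.*2.
  by case: (n) => // k; rewrite even_halfK //= oddM /= andNb.
nia.
Qed.

(** State of play after [k] rounds: Client's graph contains the path [w] on
    [k+1] vertices, latest vertex first; every edge inside [w] is claimed, no
    edge outside [w] is, and the vertices of [w] to which a vertex [x] outside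
    is joined by a claimed edge are the oldest ones, never the latest: those at
    index [l] or more. An untouched [x] has [l >= size w]. *)
Record path_state h w : Prop := PathState {
  path_uniq : uniq w;
  path_size : size w = (size h).+1;
  path_span : forall f, f \in client_edges h -> {subset f <= w};
  path_edge : forall x0 i, i.+1 < size w ->
    [set nth x0 w i; nth x0 w i.+1] \in client_edges h;
  path_inside : forall x y, x \in w -> y \in w -> x != y ->
    [set x; y] \in claimed_edges h;
  path_outside : forall x y, x \notin w -> y \notin w ->
    [set x; y] \notin claimed_edges h;
  path_frontier : forall x, x \notin w -> exists2 l, 0 < l &
    forall i, i < size w -> ([set x; nth x w i] \in claimed_edges h) = (l <= i)
}.

Section Round.

Variables (h : history n) (w : seq 'I_n).
Hypotheses (hr : reachable sigma h) (nov : ~ game_over h).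
Hypothesis st : path_state h w.
Hypothesis touch : forall e, e \in sigma h -> exists2 y, y \in e & y \in w.

Lemma offer_shape e :
    e \in sigma h ->
  exists2 x, x \notin w & exists2 i, i < size w & e = [set x; nth x w i].
Proof.
move=> eO; have := offer_unclaimed hr nov eO.
rewrite !inE => /andP[nce /cards2P[x [y [xy def_e]]]].
have [z ze zw] := touch eO.
wlog zy : x y xy def_e / z = y.
  move=> wl; move: (ze); rewrite {1}def_e !inE => /orP[]/eqP zE.
    by apply: (wl y x); rewrite 1?eq_sym 1?setUC.
  exact: (wl x y).
subst z; exists x; last first.
  by exists (index y w); rewrite ?index_mem // nth_index.
apply: contra nce => xw; rewrite def_e; exact: (path_inside st).
Qed.

(** An offer contains all or none of the unclaimed edges between a vertex [x]
    outside the path and the path. Otherwise two consecutive vertices of the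
    path would differ in this respect, and taking the offered one of these two
    edges would threaten a triangle. *)
Lemma offer_all_or_none x l i :
    x \notin w ->
    (forall i, i < size w ->
       ([set x; nth x w i] \in claimed_edges h) = (l <= i)) ->
    i < size w -> i < l ->
  ([set x; nth x w i] \in sigma h) = ([set x; nth x w 0] \in sigma h).
Proof.
move=> xw front; elim: i => // i IH iw il.
rewrite -IH; [|exact: ltnW|exact: ltnW].
have xnth j : j < size w -> x != nth x w j.
  by move=> jw; apply: contraNneq xw => {1}->; apply: mem_nth.
have iw' := ltnW iw.
have uv : nth x w i != nth x w i.+1.
  by rewrite nth_uniq ?(path_uniq st) // neq_ltn ltnSn.
have unclaimed j : j < size w -> j < l -> [set x; nth x w j] \notin sigma h ->
    forall e, [set x; nth x w j] \in unclaimed_edges ((sigma h, e) :: h).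
  move=> jw jl jO e; rewrite in_setD claimed_edges_cons in_setU (negPf jO) /=.
  by rewrite front // edge_in_Kn xnth // andbT -ltnNge.
apply/idP/idP => inO; apply: contraT => ninO; exfalso.
  apply: (@no_threat ((sigma h, [set x; nth x w i.+1]) :: h)
            x (nth x w i.+1) (nth x w i)); rewrite ?xnth // 1?eq_sym //.
  - exact: reachable_round.
  - by rewrite client_edges_cons !inE eqxx.
  - by rewrite client_edges_cons in_setU setUC (path_edge st) ?orbT.
  - by rewrite in_setU unclaimed ?orbT // ltnW.
apply: (@no_threat ((sigma h, [set x; nth x w i]) :: h)
          x (nth x w i) (nth x w i.+1)); rewrite ?xnth //.
- exact: reachable_round.
- by rewrite client_edges_cons !inE eqxx.
- by rewrite client_edges_cons in_setU (path_edge st) ?orbT.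
- by rewrite in_setU unclaimed ?orbT.
Qed.

Lemma path_extend :
  exists2 h', reachable sigma h' &
    size h' = (size h).+1 /\ exists w', path_state h' w'.
Proof.
have [_ /andP[O0 _] _] := offer_legal hr nov.
have /set0Pn[e eO] : sigma h != set0 by rewrite -card_gt0.
have [x xw [i iw def_e]] := offer_shape eO.
have [l l0 front] := path_frontier st xw.
have il : i < l.
  move: (offer_unclaimed hr nov eO); rewrite in_setD => /andP[+ _].
  by rewrite def_e front // -ltnNge.
have w0 : 0 < size w by rewrite (path_size st).
have hO : [set x; nth x w 0] \in sigma h.
  by rewrite -(offer_all_or_none xw front iw il) -def_e.
pose e' := [set x; nth x w 0].
exists ((sigma h, e') :: h); first exact: reachable_round.
split=> //; exists (x :: w); split.
- by rewrite /= xw (path_uniq st).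
- by rewrite /= (path_size st).
- move=> f; rewrite client_edges_cons in_setU1 => /orP[/eqP -> y|fC y yf].
    by rewrite !inE => /orP[->//|/eqP ->]; rewrite mem_nth ?orbT.
  by rewrite inE (path_span st fC) ?orbT.
- move=> x0 [|j] /=; rewrite ltnS client_edges_cons in_setU => jw.
    by rewrite (set_nth_default x) // inE eqxx.
  by rewrite (path_edge st) ?orbT.
- have xin y : y \in w -> [set x; y] \in claimed_edges ((sigma h, e') :: h).
    move=> yw; rewrite claimed_edges_cons in_setU.
    have jw : index y w < size w by rewrite index_mem.
    rewrite -(nth_index x yw) front //; case: (leqP l) => [|jl].
      by rewrite orbT.
    by rewrite (offer_all_or_none xw front) ?hO.
  move=> y z; rewrite !inE => /orP[/eqP->|yw] /orP[/eqP->|zw] yz.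
  + by rewrite eqxx in yz.
  + exact: xin.
  + by rewrite setUC; apply: xin.
  + by rewrite claimed_edges_cons in_setU (path_inside st) ?orbT.
- move=> y z; rewrite !inE !negb_or => /andP[_ yw] /andP[_ zw].
  rewrite claimed_edges_cons in_setU negb_or (path_outside st) // andbT.
  apply/negP => /touch[u]; rewrite !inE => /orP[]/eqP->; by apply/negP.
- move=> y; rewrite inE negb_or => /andP[yx yw].
  have [m m0 fronty] := path_frontier st yw.
  have yxF : [set y; x] \in claimed_edges ((sigma h, e') :: h) = false.
    apply/negbTE; rewrite claimed_edges_cons in_setU negb_or.
    rewrite (path_outside st) // andbT.
    by apply/negP => /touch[u]; rewrite !inE => /orP[]/eqP->; apply/negP.
  have [yO|yO] := boolP ([set y; nth y w 0] \in sigma h).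
    (* All edges from [y] to the old path are now claimed. *)
    exists 1 => // -[|j] jw //=; rewrite claimed_edges_cons in_setU fronty //.
    case: (leqP m j) => [|jm]; first by rewrite orbT.
    by rewrite (offer_all_or_none yw fronty) ?yO.
  (* No edge at [y] is offered, and indices in the path shift by one. *)
  exists m.+1 => // -[|j] jw //=; rewrite claimed_edges_cons in_setU fronty //.
  rewrite ltnS; case: (leqP m j) => [|jm]; first by rewrite orbT.
  by rewrite (offer_all_or_none yw fronty) // (negPf yO).
Qed.

End Round.

Lemma path_size_ltn h w : path_state h w -> size h < n.
Proof.
move=> st; rewrite -(path_size st) -[leqRHS]card_ord.
by rewrite -(card_uniqP (path_uniq st)) max_card.
Qed.

Lemma path_touch h w :
    reachable sigma h -> ~ game_over h -> 0 < size h -> path_state h w ->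
  forall e, e \in sigma h -> exists2 y, y \in e & y \in w.
Proof.
move=> hr nov h0 st e eO; have [/subsetP sub _ _] := offer_legal hr nov.
move: (sub e eO); rewrite /offerable_edges; case: (h) st h0 => // r h' st' _.
rewrite inE => /andP[_ /existsP[f /andP[fC /set0Pn[y]]]].
by rewrite inE => /andP[ye yf]; exists y; rewrite // (path_span st' fC).
Qed.

Lemma client_not_beaten : b.+1.*2 < n -> False.
Proof.
move=> nb.
suff grow k : exists2 h, reachable sigma h & size h = k /\
    exists2 w, path_state h w &
      forall e, e \in sigma h -> exists2 y, y \in e & y \in w.
  have [h _ [hn [w /path_size_ltn]]] := grow n.
  by rewrite hn ltnn.
elim: k => [|k [h hr [hk [w st touch]]]].
  have r0 : reachable sigma [::] by constructor.
  have nov : ~ game_over (@nil ({set edge n} * edge n)).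
    by apply: not_over; rewrite //=; lia.
  have [_ _ /(_ erefl)[v vO]] := offer_legal r0 nov.
  exists [::] => //; split=> //; exists [:: v]; last first.
    by move=> e /vO ve; exists v; rewrite ?mem_head.
  split=> //.
  - by move=> f; rewrite client_edges_nil inE.
  - by move=> x y; rewrite !inE => /eqP-> /eqP->; rewrite eqxx.
  - by move=> x y _ _; rewrite claimed_edges_nil inE.
  - by move=> x _; exists 1 => // -[|//] _; rewrite claimed_edges_nil inE.
have nov := not_over nb hr (path_size_ltn st).
have [h' hr' [hk' [w' st']]] := path_extend hr nov st touch.
exists h' => //; split; first by rewrite hk' hk.
have nov' := not_over nb hr' (path_size_ltn st').
by exists w' => //; apply: path_touch; rewrite // hk'.
Qed.

End Client.

(** * Waiter's strategy: Client's graph stays bipartite *)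

Lemma bipartite_no_odd_cycle n (A : {set 'I_n}) (F : {set edge n}) :
    (forall x y, [set x; y] \in F -> (x \in A) != (y \in A)) ->
  ~ exists2 C, odd_cycles C & C \subset F.
Proof.
move=> cutA [_ [c [c_uniq _ c_odd ->]] /subsetP cF].
have {cF} cF x : x \in c -> (next c x \in A) = ~~ (x \in A).
  move=> xc; have /cutA : [set x; next c x] \in F by apply/cF/imset_f.
  by case: (x \in A); case: (_ \in A).
case: c => // x p in c_uniq c_odd cF.
have walk : path (fun u v => (v \in A) == ~~ (u \in A)) x (rcons p x).
  rewrite -[path _ _ _]/(path.cycle _ (x :: p)).
  apply: (sub_in_cycle (P := mem (x :: p))) (cycle_next c_uniq).
    by move=> u v uc _ /eqP <-; apply/eqP/cF.
  exact/allP.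
have parity u q : path (fun u v => (v \in A) == ~~ (u \in A)) u q ->
    (last u q \in A) = odd (size q) (+) (u \in A).
  elim: q u => //= v q IH u /andP[/eqP uv /IH ->].
  by rewrite uv; case: (u \in A); case: odd.
have := parity x _ walk; rewrite last_rcons size_rcons.
by move: c_odd => /= ->; case: (x \in A).
Qed.

Section Waiter.

Variables (m b : nat).
Local Notation n := m.+1.
Hypothesis n_small : n <= b.+1.*2.
Implicit Types (p : {perm 'I_n}) (h : history n) (R : nat -> nat -> bool).

(** Waiter keeps the vertices in a linear order, [p x] being the position of
    [x]. [edges_at p R] consists of the edges whose endpoints have positions
    related by the symmetric relation [R]. *)
Definition edges_at p R : {set edge n} :=
  [set [set u.1; u.2] | u : 'I_n * 'I_n & (u.1 != u.2) && R (p u.1) (p u.2)].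

Lemma edges_atP p R e :
  reflect (exists x y, [/\ x != y, R (p x) (p y) & e = [set x; y]])
          (e \in edges_at p R).
Proof.
apply: (iffP imsetP) => [[[x y]]|[x [y [xy Rxy ->]]]].
  by rewrite inE /= => /andP[xy Rxy] ->; exists x, y.
by exists (x, y); rewrite ?inE //= xy.
Qed.

Lemma edges_atE p R x y :
    (forall i j, R i j = R j i) -> x != y ->
  ([set x; y] \in edges_at p R) = R (p x) (p y).
Proof.
move=> Rsym xy.
apply/edges_atP/idP => [[u [v [uv Ruv /setP eq_e]]]|Rxy]; last first.
  by exists x, y.
have := eq_e x; have := eq_e y; rewrite !inE !eqxx orbT /= => /esym + /esym.
case/orP => /eqP def_y /orP[] /eqP def_x; subst.
all: by rewrite ?eqxx // in xy *; rewrite // Rsym.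
Qed.

Lemma pos_neq p x y : x != y -> p x != p y :> nat.
Proof. by rewrite val_eqE (inj_eq perm_inj). Qed.

(** The pairs of positions that are claimed after [k] rounds: all pairs among
    the first [k+1] positions, which Client's tree occupies, and for [j] outside
    the tree the pairs of [j] with the first [min k (j - (b+1))] positions. *)
Definition taken k i j : bool :=
  (maxn i j <= k) || ((minn i j < k) && (minn i j + b.+1 < maxn i j)).

(** The pairs of positions offered in round [k+1]: the remaining edges from
    position [k+1] to the tree, and some edges from the latest vertex of the
    tree, in position [k]. *)
Definition offered k i j : bool := taken k.+1 i j && ~~ taken k i j.

Lemma taken_sym k i j : taken k i j = taken k j i.
Proof. by rewrite /taken maxnC minnC. Qed.

Lemma offered_sym k i j : offered k i j = offered k j i.
Proof. by rewrite /offered !(taken_sym _ i). Qed.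

(** The offered edges are numbered by [t <= b]: for [t <= k] from position
    [k - t] to [k + 1], for [t > k] from position [k] to [b + 1 + t]. Only here is
    the bound on [n] needed. *)
Lemma card_offered p k : k < m -> #|edges_at p (offered k)| <= b.+1.
Proof.
move=> km; pose v i := (p^-1)%g (inord i : 'I_n).
pose f (t : 'I_b.+1) : edge n :=
  if t <= k then [set v (k - t); v k.+1] else [set v k; v (b.+1 + t)].
rewrite -[leqRHS]card_ord -cardsT.
apply: leq_trans (leq_imset_card f _).
apply/subset_leq_card/subsetP => _ /edges_atP[x [y [xy Rxy ->]]].
wlog lt_xy : x y xy Rxy / p x < p y.
  move=> wl; have [lt|lt|eq_xy] := ltngtP (p x) (p y); first exact: wl.
    by rewrite setUC; apply: wl; rewrite // 1?eq_sym // offered_sym.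
  by rewrite (perm_inj (val_inj eq_xy)) eqxx in xy.
have vE z i : p z = i :> nat -> v i = z.
  by move=> <-; rewrite /v inord_val permK.
have yn := ltn_ord (p y).
have [y_k|y_k] := eqVneq (p y : nat) k.+1.
  have tb : k - p x < b.+1 by move: Rxy; rewrite /offered /taken; lia.
  apply/imsetP; exists (Ordinal tb); rewrite ?inE // /f /= leq_subr.
  by rewrite (vE x) ?(vE y) //; lia.
have x_k : p x = k :> nat by move: Rxy y_k; rewrite /offered /taken; lia.
have tb : p y - b.+1 < b.+1 by move: yn n_small; lia.
apply/imsetP; exists (Ordinal tb); rewrite ?inE // /f /= ifN.
  by rewrite (vE x) ?(vE y) //; move: Rxy y_k x_k; rewrite /offered /taken; lia.
by move: Rxy y_k x_k; rewrite /offered /taken; lia.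
Qed.

(** Positions [k+1] and [j] have the same claimed edges after round [k+1] if
    an extra edge to position [j] is offered in this round. *)
Lemma taken_swap p k (j : 'I_n) (k1 : 'I_n) :
    k1 = k.+1 :> nat -> (j == k1) || (k + b.+1 < j) ->
  edges_at (p * tperm k1 j)%g (taken k.+1) = edges_at p (taken k.+1).
Proof.
move=> k1E jk.
have swap (i i' : 'I_n) : i != i' ->
    taken k.+1 (tperm k1 j i) (tperm k1 j i') = taken k.+1 i i'.
  move=> ii'; have [->|jk1] := eqVneq j k1; first by rewrite tperm1 !perm1.
  rewrite (negPf jk1) /= in jk; rewrite /taken.
  case: tpermP => [iE|iE|/eqP iE /eqP iE'];
    case: tpermP => [i'E|i'E|/eqP i'E /eqP i'E'];
    subst; rewrite ?eqxx // in ii'; move: ii'; rewrite -?val_eqE /= in jk1 *;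
    try (rewrite -val_eqE /= in iE iE'); try (rewrite -val_eqE /= in i'E i'E');
    lia.
apply/setP => e; apply/edges_atP/edges_atP => -[x [y [xy Rxy ->]]];
  exists x, y; split=> //; move: Rxy; rewrite !permM swap ?(inj_eq perm_inj) //.
Qed.

(** State of play under Waiter's strategy. Client's edges lie within the first
    [size h + 1] positions and, after the first round, cover them, which makes
    the next offer legal; [A] is one side of a bipartition of Client's graph. *)
Record waiter_state h p : Prop := WaiterState {
  waiter_size : size h < n;
  waiter_claimed : claimed_edges h = edges_at p (taken (size h));
  waiter_span : forall f x, f \in client_edges h -> x \in f -> p x <= size h;
  waiter_cover : 0 < size h -> forall x, p x <= size h ->
    exists2 f, f \in client_edges h & x \in f;
  waiter_cut : exists A : {set 'I_n},
    forall x y, [set x; y] \in client_edges h -> (x \in A) != (y \in A)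
}.

Lemma all_taken h p :
  waiter_state h p -> size h = m -> unclaimed_edges h = set0.
Proof.
move=> st hm; apply/setP => e; rewrite in_setD in_set0.
apply/negP => /andP[+ eK]; rewrite (waiter_claimed st) => /negP; apply.
move: eK; rewrite inE => /cards2P[x [y [xy ->]]].
rewrite edges_atE //; last exact: taken_sym.
by rewrite /taken hm; have := ltn_ord (p x); have := ltn_ord (p y); lia.
Qed.

Lemma offer_is_legal h p :
  waiter_state h p -> size h < m ->
  legal_offer b h (edges_at p (offered (size h))).
Proof.
move=> st hm; pose v i := (p^-1)%g (inord i : 'I_n).
have pv i : i <= m -> p (v i) = i :> nat by move=> im; rewrite permKV inordK.
split.
- apply/subsetP => e /edges_atP[x [y [xy Rxy ->]]].
  have un : [set x; y] \in unclaimed_edges h.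
    rewrite in_setD edge_in_Kn xy (waiter_claimed st) edges_atE //;
      last exact: taken_sym.
    by rewrite andbT; case/andP: Rxy.
  wlog x_h : x y xy Rxy un / p x <= size h.
    move=> wl; have [|x_h] := leqP (p x) (size h); first exact: wl.
    have y_h : p y <= size h.
      by move: Rxy (pos_neq p xy); rewrite /offered /taken; lia.
    by rewrite setUC; apply: wl; rewrite // 1?eq_sym 1?offered_sym 1?setUC.
  case: h st hm Rxy un x_h => // r h st hm Rxy un x_h.
  rewrite inE un; apply/existsP.
  have [//|f fC xf] := waiter_cover st _ x_h; exists f; rewrite fC.
  by apply/set0Pn; exists x; rewrite !inE eqxx xf.
- rewrite card_offered // andbT card_gt0; apply/set0Pn.
  exists [set v (size h); v (size h).+1].
  have nv : v (size h) != v (size h).+1.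
    rewrite -(inj_eq (@perm_inj _ p)) -val_eqE /= !pv // 1?ltnW //.
    by rewrite neq_ltn ltnSn.
  rewrite edges_atE //; last exact: offered_sym.
  by rewrite !pv // 1?ltnW // /offered /taken; lia.
- move=> h0; exists (v 0) => _ /edges_atP[x [y [xy Rxy ->]]].
  have : (p x == 0 :> nat) || (p y == 0 :> nat).
    by move: Rxy (pos_neq p xy); rewrite h0 /offered /taken /=; lia.
  have vE z : p z == 0 :> nat -> v 0 = z.
    by move=> /eqP <-; rewrite /v inord_val permK.
  by rewrite !inE => /orP[] /vE ->; rewrite eqxx ?orbT.
Qed.

(** The new vertex [w] goes to position [size h + 1] and to the side of the
    bipartition opposite to its only neighbour [u]. *)
Lemma waiter_step h p e :
    waiter_state h p -> size h < m -> e \in edges_at p (offered (size h)) ->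
  exists p', waiter_state ((edges_at p (offered (size h)), e) :: h) p'.
Proof.
move=> st hm /edges_atP[u [w [uw Ruw def_e]]].
wlog [u_h w_h] : u w uw Ruw def_e / p u <= size h /\ size h < p w.
  move=> wl; have ne := pos_neq p uw.
  have [u_h|u_h] := leqP (p u) (size h).
    apply: (wl u w) => //; split=> //.
    by move: Ruw ne; rewrite /offered /taken; lia.
  apply: (wl w u); rewrite // 1?eq_sym 1?offered_sym 1?setUC //.
  by split=> //; move: Ruw ne; rewrite /offered /taken; lia.
pose k1 : 'I_n := inord (size h).+1.
have k1E : k1 = (size h).+1 :> nat by rewrite /k1 inordK.
have swap_ok : (p w == k1) || (size h + b.+1 < p w).
  by rewrite -val_eqE /= k1E; move: Ruw; rewrite /offered /taken; lia.
pose p' := (p * tperm k1 (p w))%g.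
have p'w : p' w = (size h).+1 :> nat by rewrite permM tpermR.
have p'E x : p x <= size h -> p' x = p x.
  move=> xh; rewrite permM tpermD // -val_eqE /= ?k1E; move: xh w_h; lia.
have p'V x : p' x <= size h -> p x <= size h.
  rewrite permM; case: tpermP => [->|->|//]; rewrite ?k1E; move: w_h; lia.
exists p'; split; rewrite /= ?client_edges_cons.
- by rewrite ltnS.
- rewrite claimed_edges_cons (taken_swap _ k1E swap_ok) (waiter_claimed st) /=.
  apply/setP => f; rewrite in_setU; apply/orP/edges_atP => [[]/edges_atP|].
  + by case=> x [y [xy /andP[Rxy _] ->]]; exists x, y.
  + case=> x [y [xy Rxy ->]]; exists x, y; split=> //.
    by move: Rxy; rewrite /taken; lia.
  + case=> x [y [xy Rxy ->]]; rewrite !edges_atE //;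
      [|exact: taken_sym|exact: offered_sym].
    by rewrite /offered Rxy; case: taken; [right|left].
- move=> f x; rewrite in_setU1 => /orP[/eqP ->|fC xf].
    rewrite def_e !inE => /orP[]/eqP ->; last by rewrite p'w.
    by rewrite p'E // leqW.
  by rewrite p'E ?leqW // (waiter_span st fC).
- move=> _ x; rewrite leq_eqVlt => /orP[/eqP p'x|].
    exists e; rewrite ?setU11 // def_e !inE.
    suff -> : x = w by rewrite eqxx orbT.
    by apply: (@perm_inj _ p'); apply: val_inj; rewrite /= p'x p'w.
  rewrite ltnS => /p'V xh; have [h0|h0] := posnP (size h).
    exists e; rewrite ?setU11 // def_e !inE.
    suff -> : x = u by rewrite eqxx.
    by apply: (@perm_inj _ p); apply: val_inj => /=; move: xh u_h; lia.
  have [f fC xf] := waiter_cover st h0 xh.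
  by exists f; rewrite // in_setU1 fC orbT.
- have [A cutA] := waiter_cut st.
  have wC f : f \in client_edges h -> w \notin f.
    by move=> fC; apply/negP => /(waiter_span st fC); rewrite leqNgt w_h.
  exists (if u \in A then A :\ w else w |: A) => x y.
  rewrite in_setU1 => /orP[/eqP|xyC]; last first.
    have := wC _ xyC; rewrite !inE negb_or ![w == _]eq_sym => /andP[xw yw].
    have := cutA _ _ xyC.
    by case: ifP => _; rewrite !inE (negPf xw) (negPf yw).
  rewrite def_e => /setP eq_e; have xy : x != y.
    apply: contra uw => /eqP xy; move: (eq_e u) (eq_e w).
    by rewrite xy !inE !eqxx !orbb orbT => /eqP -> /eqP ->.
  have cut_uw (B := if u \in A then A :\ w else w |: A) :
      (u \in B) != (w \in B).
    by rewrite /B; case: ifP => uA; rewrite !inE eqxx (negPf uw) /= uA.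
  have := eq_e x; have := eq_e y; rewrite !inE !eqxx orbT /=.
  move=> /esym/orP[]/eqP yE /esym/orP[]/eqP xE; subst.
  all: by rewrite ?eqxx // in xy *; rewrite // eq_sym.
Qed.

Lemma bipartite_waiter_wins : waiter_wins b (@odd_cycles n).
Proof.
apply: (invariant_waiter_wins (I := fun h => exists p, waiter_state h p)).
- exists 1%g; split=> //=.
  + rewrite claimed_edges_nil; apply/esym/setP => e; rewrite inE.
    apply/edges_atP => -[x [y [xy]]]; rewrite !perm1 /taken => Rxy _.
    by move: xy; rewrite -val_eqE /=; move: Rxy; lia.
  + by move=> f x; rewrite client_edges_nil inE.
  + by exists set0 => x y; rewrite client_edges_nil inE.
- move=> h [p st] nov; have hm : size h < m.
    have := waiter_size st; rewrite ltnS leq_eqVlt => /orP[/eqP hm|//].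
    case: nov; apply/eqP; rewrite -subset0 -(all_taken st hm).
    exact: offerable_unclaimed.
  exists (edges_at p (offered (size h))); split; first exact: offer_is_legal.
  by move=> e; apply: waiter_step.
- move=> h [p st] ov; split; last first.
    by have [A cutA] := waiter_cut st; apply: bipartite_no_odd_cycle cutA.
  apply: (all_taken st); have := waiter_size st.
  rewrite ltnS leq_eqVlt => /orP[/eqP //|hm].
  have [/subsetP sub /andP[+ _] _] := offer_is_legal st hm.
  by rewrite card_gt0 => /set0Pn[e /sub]; rewrite ov inE.
Qed.

End Waiter.

Theorem theorem1p3 (n : nat) (hn : 0 < n) :
  is_threshold_bias (@odd_cycles n) (uphalf n - 1).
Proof.
move=> b; split=> [[sigma wins]|le_b].
  rewrite leqNgt; apply/negP => lt_b.
  by apply: (client_not_beaten wins); move: lt_b; lia.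
case: n hn le_b => // m _ le_b.
by apply: bipartite_waiter_wins; move: le_b; lia.
Qed.
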